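(* Let $\mathcal{F}$ denote the class of all forests. Then, as $n\to\infty$, \[ \mathrm{RFF}_{\mathcal{F}}(n) = \left(\tfrac{1}{2}\pm o(1)\right)\cdot \frac{\ln n}{\ln\ln n}, \] that is, $\mathrm{RFF}_{\mathcal{F}}(n) \le \left(\tfrac12+o(1)\right)\frac{\ln n}{\ln\ln n}$ and $\mathrm{RFF}_{\mathcal{F}}(n) \ge \left(\tfrac12-o(1)\right)\frac{\ln n}{\ln\ln n}$.
   Context: For a finite graph $G=(V,E)$ and a linear order (presentation order) $v_1 \ll v_2 \ll \dots \ll v_n$ of $V$, the First-Fit algorithm processes the vertices in this order and assigns to $v_t$ the least positive integer not already used as a color on a neighbor of $v_t$ among $v_1,\dots,v_{t-1}$. Let $\chi_{\mathrm{FF}}(G,\ll)$ be the number of distinct colors First-Fit uses, and $\chi(G)$ the chromatic number of $G$. For a class of graphs $\mathcal{G}$, define \[ \mathrm{RFF}_{\mathcal{G}}(n) = \max_{G\in\mathcal{G},\ |V(G)|=n} \mathbb{E}_{\ll}\left[\frac{\chi_{\mathrm{FF}}(G,\ll)}{\chi(G)}\right], \] where the expectation is over a presentation order $\ll$ chosen uniformly at random among all $n!$ orders of $V(G)$. Here $\ln$ is the natural logarithm. *)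

(* Defs.v *)
From HB Require Import structures.
From mathcomp Require Import all_boot all_order all_algebra.
From mathcomp Require Import all_classical all_reals all_analysis.

Set Implicit Arguments.
Unset Strict Implicit.
Unset Printing Implicit Defensive.

Import Order.TTheory GRing.Theory Num.Theory.
Import numFieldNormedType.Exports.

Local Open Scope ring_scope.

Record sgraph (V : finType) := SGraph {
  edges : {set {set V}};
  _ : [forall e in edges, #|e| == 2%N] }.

HB.instance Definition _ (V : finType) := [isSub for @edges V].
HB.instance Definition _ (V : finType) := [Finite of sgraph V by <:].

(* Irreflexive, since [set u; u] is a singleton and edges are pairs. *)
Definition adj (V : finType) (G : sgraph V) : rel V :=
  fun u v => [set u; v]%SET \in edges G.

Definition graph_class := forall V : finType, sgraph V -> Prop.

(* The bound on the size excludes the degenerate cycle u, v, u along one edge. *)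
Definition forest : graph_class := fun V G =>
  forall c : seq V, (2 < size c)%N -> ~ ucycle (adj G) c.

Definition colorable (V : finType) (G : sgraph V) (k : nat) : bool :=
  [exists f : {ffun V -> 'I_k},
    [forall u, forall v, adj G u v ==> (f u != f v)]].

Lemma ex_colorable (V : finType) (G : sgraph V) : exists k, colorable G k.
Proof.
exists #|V|; apply/existsP; exists [ffun v => enum_rank v].
apply/'forall_forallP => u v; apply/implyP; rewrite !ffunE => uv.
apply: contraTneq uv => /enum_rank_inj <-; rewrite /adj finset.setUid.
case: G => E /= /'forall_implyP EP; apply/negP => /EP.
by rewrite cards1.
Qed.

Definition chi (V : finType) (G : sgraph V) : nat := ex_minn (ex_colorable G).

Lemma ex_fresh (s : seq nat) : exists k, (0 < k)%N && (k \notin s).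
Proof.
exists (\max_(i <- s) i).+1; apply/negP => /(@leq_bigmax_seq _ s xpredT id).
by move=> /(_ isT); rewrite ltnn.
Qed.

Definition least_fresh (s : seq nat) : nat := ex_minn (ex_fresh s).

(* Color 0 means "not yet presented": unpresented neighbors never block a
   color, since only positive colors are assigned. *)
Definition ff_step (V : finType) (G : sgraph V) (c : V -> nat) (v : V) :
    V -> nat :=
  fun u => if u == v then least_fresh [seq c w | w <- enum V & adj G v w]
           else c u.

Definition first_fit (V : finType) (G : sgraph V) (s : seq V) : V -> nat :=
  foldl (ff_step G) (fun=> 0%N) s.

Definition chi_FF (V : finType) (G : sgraph V) (s : seq V) : nat :=
  size (undup [seq first_fit G s v | v <- s]).

(* permutations (enum V) lists each of the |V|! linear orders on V once, as
   the sequence of the vertices in order of presentation. *)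
Definition expected_FF_ratio (R : realType) (V : finType) (G : sgraph V) : R :=
  (\sum_(s <- permutations (enum V)) (chi_FF G s)%:R / (chi G)%:R)
    / (#|V| `!)%:R.

(* Up to isomorphism the n-vertex graphs are those on 'I_n. The ratios are
   nonnegative, so the default value 0 does not affect the maximum. *)
Definition RFF (R : realType) (C : graph_class) (n : nat) : R :=
  \big[Num.max/0]_(G : sgraph 'I_n | `[< C _ G >]) expected_FF_ratio R G.

(* Main.v *)
(* Upper bound. Root the forest, so that every neighbor of a vertex is its parent
   or one of its children. Below a vertex of color M one can walk down through
   earlier and earlier children of successive colors: only at the first step may
   the parent get in the way, which costs one color. Hence M - K bottom vertices
   see the K vertices above them presented in increasing order. An upward path is
   determined by its bottom, so the expected number of such vertices is at most
   n / K!, and First-Fit uses at most K + n / K! colors on average.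

   Lower bound. Take the numbers below n written in base m + 1, the parent of a
   number being obtained by clearing its lowest nonzero digit. Draw independent
   uniform windows in {0, ..., K - 1} for the vertices and present them window by
   window. A vertex whose lowest nonzero digit is at position k gets color k + 1
   when it lies in window k and, for each i < k, one of its m children at position
   i does so recursively. For m of order K ln K this works for all K colors with
   probability 1 - O(1/K), while (m + 1)^K = n already for
   K = (1 - o(1)) ln n / ln ln n. *)
Require Import Defs.
From HB Require Import structures.
From mathcomp Require Import all_boot all_order all_fingroup all_algebra.
From mathcomp Require Import all_classical all_reals all_analysis.
From mathcomp Require Import zify lra ring.

Set Implicit Arguments.
Unset Strict Implicit.
Unset Printing Implicit Defensive.

Import Order.TTheory GRing.Theory Num.Theory.
Import numFieldNormedType.Exports.

Local Open Scope classical_set_scope.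
Local Open Scope ring_scope.

(** * Local characterization of First-Fit colors *)

Section FirstFit.
Variables (V : finType) (G : sgraph V).
Implicit Types (s : seq V) (u v w : V).

Lemma adj_sym : symmetric (adj G).
Proof. by move=> u v; rewrite /adj finset.setUC. Qed.

Lemma adjxx u : adj G u u = false.
Proof.
rewrite /adj finset.setUid; apply/negbTE.
case: G => E /= /'forall_implyP EP; apply/negP => /EP.
by rewrite cards1.
Qed.

Lemma first_fit_rcons s v :
  first_fit G (rcons s v) = ff_step G (first_fit G s) v.
Proof. by rewrite /first_fit -cats1 foldl_cat. Qed.

Lemma first_fit_notin s v : v \notin s -> first_fit G s v = 0%N.
Proof.
elim/last_ind: s => [//|s x IHs]; rewrite mem_rcons inE negb_or => /andP[vx vs].
by rewrite first_fit_rcons /ff_step (negbTE vx) IHs.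
Qed.

Definition before s : rel V := fun u v => (index u s < index v s)%N.

Lemma before_mem s u v : before s u v -> u \in s.
Proof. by rewrite /before -index_mem => /leq_trans; apply; apply: index_size. Qed.

Lemma before_rcons s x u v : u \in s -> v \in s ->
  before (rcons s x) u v = before s u v.
Proof. by move=> us vs; rewrite /before -cats1 !index_cat us vs. Qed.

Lemma before_last s x u : u \in s -> x \notin s -> before (rcons s x) u x.
Proof.
move=> us xs; rewrite /before -cats1 !index_cat us (negbTE xs) /= eqxx addn0.
by rewrite index_mem.
Qed.

Lemma least_freshP (t : seq nat) :
  [/\ (0 < least_fresh t)%N, least_fresh t \notin t &
      forall c, (0 < c < least_fresh t)%N -> c \in t].
Proof.
rewrite /least_fresh; case: ex_minnP => m /andP[m0 mt] mmin; split=> // c.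
move=> /andP[c0 cm]; apply: contraTT cm => ct; rewrite -leqNgt.
by apply: mmin; rewrite c0.
Qed.

(** Presenting one more vertex alters neither the colors nor the relative order of the earlier ones,
    so only the last vertex needs checking, where [least_freshP] applies. Later arguments about
    colors go through these three clauses. *)
Lemma first_fit_spec s v : uniq s -> v \in s ->
  [/\ (0 < first_fit G s v)%N,
      forall u, adj G v u -> before s u v -> first_fit G s u != first_fit G s v
    & forall c, (0 < c < first_fit G s v)%N ->
      exists u, [/\ adj G v u, before s u v & first_fit G s u = c]].
Proof.
elim/last_ind: s => [//|s x IHs] in v *; rewrite rcons_uniq => /andP[xs us].
rewrite mem_rcons inE first_fit_rcons.
have step u : u \in s -> ff_step G (first_fit G s) x u = first_fit G s u.
  by move=> us'; rewrite /ff_step; case: eqP us' xs => // -> ->.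
case: (eqVneq v x) => [-> _|vx /= vs]; last first.
  have [c0 c1 c2] := IHs v us vs; rewrite step //; split=> //.
    move=> u vu uv; have /[!(mem_rcons, inE)] := before_mem uv.
    case: (eqVneq u x) => [ux|_ /= us'].
      move: uv; rewrite ux /before => /ltnW; rewrite leqNgt.
      by have /= := before_last vs xs; rewrite /before => ->.
    by rewrite step//; apply: c1 => //; rewrite -(before_rcons x).
  move=> c /c2[u [vu uv uc]]; exists u; have us' := before_mem uv.
  by rewrite before_rcons// step.
set t := [seq first_fit G s w | w <- enum V & adj G x w].
have [c0 c1 c2] := least_freshP t.
have -> : ff_step G (first_fit G s) x x = least_fresh t by rewrite /ff_step eqxx.
split=> // [u xu ux|c /[dup] /andP[cgt0 _] /c2 /mapP[u]].
  have /[!(mem_rcons, inE)] := before_mem ux.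
  case: (eqVneq u x) => [uex|_ /= us']; first by rewrite uex adjxx in xu.
  rewrite step//; apply: contraNneq c1 => <-; apply/mapP; exists u => //.
  by rewrite mem_filter xu mem_enum.
rewrite mem_filter => /andP[xu _] cu; exists u.
(* Unpresented vertices still have color 0, so a neighbor of positive color has been presented. *)
have us' : u \in s.
  by apply: contraTT cgt0 => us'; rewrite cu first_fit_notin.
by rewrite step// before_last.
Qed.

End FirstFit.

(** * Uniformly random presentation orders *)

Section Permutations.
Variable V : finType.
Implicit Types (s t p : seq V).

(** The positionwise bijection from [p] to [t], extended by the identity, is injective because both
    lists have the same elements. *)
Lemma perm_extension p t : uniq p -> perm_eq p t ->
  exists sigma : {perm V}, map sigma p = t.
Proof.
move=> up pt; have ut : uniq t by rewrite -(perm_uniq pt).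
have szt := perm_size pt.
pose f x := if x \in p then nth x t (index x p) else x.
have ft x : (f x \in t) = (x \in p).
  rewrite /f; case: ifP => xp; first by rewrite mem_nth // -szt index_mem.
  by rewrite -(perm_mem pt).
have finj : injective f.
  move=> x y fxy; have := ft x; rewrite fxy ft => yx.
  move: fxy; rewrite /f -yx; case: ifP => // yp.
  have xp : x \in p by rewrite -yx.
  have xi : (index x p < size t)%N by rewrite -szt index_mem.
  have yi : (index y p < size t)%N by rewrite -szt index_mem.
  rewrite (set_nth_default x y yi) => /eqP; rewrite nth_uniq// => /eqP ixy.
  by rewrite -(nth_index x xp) -(nth_index x yp) ixy.
exists (perm finj); have [p0|] := posnP (size p).
  by rewrite (@size0nil _ t) -?szt//; apply: size0nil; rewrite size_map.
rewrite -has_predT => /hasP[x0 _ _].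
apply: (@eq_from_nth _ x0); first by rewrite size_map.
move=> i; rewrite size_map => ip; rewrite (nth_map x0)// permE /f mem_nth//.
by rewrite index_uniq//; apply: set_nth_default; rewrite -szt.
Qed.

(** The symmetric group acts simply transitively on linear orders, so any reference order [t]
    parametrizes them all. *)
Lemma permutations_enumE t : perm_eq t (enum V) ->
  perm_eq (permutations (enum V)) [seq map sigma t | sigma : {perm V}].
Proof.
move=> te; apply: uniq_perm; first exact: permutations_uniq.
  rewrite map_inj_uniq ?enum_uniq// => sigma rho st; apply/permP => x.
  have : x \in t by rewrite (perm_mem te) mem_enum.
  by have /eq_in_map := st; apply.
move=> s; rewrite mem_permutations; apply/idP/mapP => [se|[sigma _ ->]].
  have ut : uniq t by rewrite (perm_uniq te) enum_uniq.
  have [|sigma <-] := @perm_extension t s ut.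
    by rewrite (perm_trans te)// perm_sym.
  by exists sigma; rewrite // mem_enum.
apply: uniq_perm; rewrite ?enum_uniq//.
  by rewrite (map_inj_uniq perm_inj) (perm_uniq te) enum_uniq.
move=> x; rewrite mem_enum inE -[x](permKV sigma) mem_map; last exact: perm_inj.
by rewrite (perm_mem te) mem_enum.
Qed.

Lemma sum_permutationsE (R : nmodType) (F : seq V -> R) t :
  perm_eq t (enum V) ->
  \sum_(s <- permutations (enum V)) F s
    = \sum_(sigma : {perm V}) F (map sigma t).
Proof. by move=> te; rewrite (perm_big _ (permutations_enumE te)) big_image. Qed.

Lemma sum_permutations_map (R : nmodType) (F : seq V -> R) (rho : {perm V}) :
  \sum_(s <- permutations (enum V)) F (map rho s)
    = \sum_(s <- permutations (enum V)) F s.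
Proof.
rewrite !(@sum_permutationsE _ _ (enum V))//.
rewrite [RHS](reindex_inj (mulIg rho)); apply: eq_bigr => sigma _.
by rewrite -map_comp; congr (F _); apply: eq_map => x /=; rewrite permM.
Qed.

Lemma size_permutations_enum : size (permutations (enum V)) = #|V| `!.
Proof. by rewrite size_permutations ?enum_uniq// cardE. Qed.

Lemma before_trans s : transitive (before s).
Proof. by move=> u v w; rewrite /before; apply: ltn_trans. Qed.

Lemma before_irr s : irreflexive (before s).
Proof. by move=> u; rewrite /before ltnn. Qed.

(* The [(size p)`!] rearrangements of [p] are equally likely to be the order in
   which the vertices of [p] are presented, and these events are exclusive. *)
Lemma count_sorted_before p :
  ((size p)`! * count (fun s => sorted (before s) p) (permutations (enum V))
     <= #|V| `!)%N.
Proof.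
(* A list with a repetition is never sorted for a strict order. This matters because trajectories of
   a total parent map may loop. *)
have [up|nup] := boolP (uniq p); last first.
  rewrite (_ : count _ _ = 0%N) ?muln0// -(count_pred0 (permutations (enum V))).
  apply: eq_count => s; apply: contraNF nup.
  by apply: sorted_uniq; [exact: before_trans | exact: before_irr].
set P := permutations (enum V).
have le_count t : t \in permutations p ->
    (count (fun s => sorted (before s) p) P
       <= count (fun s => sorted (before s) t) P)%N.
  rewrite mem_permutations perm_sym => /(perm_extension up)[sigma <-].
  rewrite -!sum1_count big_mkcond [leqRHS]big_mkcond /=.
  rewrite -[leqRHS](sum_permutations_map
    (fun s => if sorted (before s) (map sigma p) then 1 else 0)%N sigma).
  apply: leq_sum => s _; case: ifP => // ps; rewrite sorted_map.
  rewrite (@eq_sorted _ _ (before s)) ?ps// => x y.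
  by rewrite /= /before !index_map//; exact: perm_inj.
have -> : (size p)`! = size (permutations p) by rewrite size_permutations.
rewrite -sum1_size big_distrl /= -size_permutations_enum -/P.
apply: (@leq_trans
  (\sum_(t <- permutations p) count (fun s => sorted (before s) t) P)%N).
  rewrite big_seq_cond [leqRHS]big_seq_cond; apply: leq_sum => t /andP[tp _].
  by rewrite mul1n; apply: le_count.
under eq_bigr do rewrite -sum1_count big_mkcond /=.
rewrite exchange_big /= -sum1_size; apply: leq_sum => s _.
rewrite -big_mkcond sum1_count -size_filter.
set f := seq.filter _ _.
have uf : uniq f by rewrite filter_uniq// permutations_uniq.
case E : f uf => [|a [|b f']]//= /andP[]; rewrite inE negb_or => /andP[/eqP ab _] _.
exfalso; apply: ab.
have : a \in f by rewrite E mem_head.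
have : b \in f by rewrite E !inE eqxx orbT.
rewrite !mem_filter !mem_permutations => /andP[sb pb] /andP[sa pa].
apply: (irr_sorted_eq (@before_trans s) (@before_irr s)) => //.
by move=> x; rewrite (perm_mem pa) (perm_mem pb).
Qed.

End Permutations.

(** * Rooting a forest *)

Section ForestParent.
Variables (V : finType) (G : sgraph V).
Hypothesis forestG : forest G.

(** If every vertex of [S] had two neighbors in [S], a simple path could always be prolonged at its
    head without closing a cycle, and would outgrow [V]. *)
Lemma forest_leaf (S : {set V}) (x0 : V) : x0 \in S ->
  exists2 v, v \in S &
    {in S &, forall u u', adj G v u -> adj G v u' -> u = u'}.
Proof.
move=> x0S; apply: contrapT => noleaf.
have deg2 v : v \in S -> forall z, exists y, [/\ y \in S, adj G v y & y != z].
  move=> vS z; apply: contrapT => one; apply: noleaf; exists v => // u u' uS u'S.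
  have only y : y \in S -> adj G v y -> y = z.
    by move=> yS vy; apply/eqP/negPn/negP => yz; apply: one; exists y.
  by move=> /(only _ uS)-> /(only _ u'S)->.
have long r : exists x p,
    [/\ size p = r, path (adj G) x p, uniq (x :: p) & all (mem S) (x :: p)].
  elim: r => [|r [x [p [szp px upx inS]]]].
    by exists x0, [::]; split; rewrite //= ?x0S.
  have xS : x \in S by case/andP: inS.
  have [y [yS xy yhd]] := deg2 x xS (head x p).
  have yx : y != x by apply: contraTneq xy => ->; rewrite adjxx.
  case: (boolP (y \in p)) => [yp|ynp]; last first.
    exists y, (x :: p); split=> //=; first by rewrite szp.
    - by rewrite adj_sym xy.
    - by rewrite inE negb_or yx ynp.
    - by rewrite yS.
  (* Returning to the path closes a cycle, of length at least 3 because [y] is not the second vertex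
     of the path. *)
  exfalso; case/splitPr: yp => p1 p2 in px upx yhd {inS szp} *.
  apply: (@forestG (x :: rcons p1 y)).
    by rewrite /= size_rcons; case: p1 yhd {px upx} => //=; rewrite eqxx.
  rewrite /ucycle /=; apply/andP; split.
    rewrite rcons_path last_rcons adj_sym xy andbT.
    by move: px; rewrite -cat_rcons cat_path => /andP[].
  move: upx; rewrite -cat_rcons -cat_cons cat_uniq => /andP[] //.
have [x [p [szp _ upx _]]] := long #|V|.
by have := max_card (mem (x :: p)); rewrite (card_uniqP upx) /= szp ltnn.
Qed.

(** Leaves are peeled off one at a time; the parent of a leaf is its only remaining neighbor, so
    each edge is oriented when its first endpoint is removed. *)
Lemma forest_parent :
  exists par : V -> V, forall u v, adj G u v -> par u = v \/ par v = u.
Proof.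
suff: forall r (S : {set V}), #|S| = r ->
    exists par : V -> V, {in S &, forall u v, adj G u v -> par u = v \/ par v = u}.
  move=> /(_ _ [set: V]%SET erefl)[par parP]; exists par => u v.
  by apply: parP; rewrite finset.in_setT.
elim=> [|r IHr] S cS.
  exists id => u v; move/eqP: cS; rewrite cards_eq0 => /eqP->.
  by rewrite finset.in_set0.
have [x0 x0S] : exists x, x \in S by apply/card_gt0P; rewrite cS.
have [v vS leafv] := forest_leaf x0S.
have [|par parP] := IHr (S :\ v)%SET.
  by apply: succn_inj; rewrite -cS (finset.cardsD1 v S) vS.
(* The default [v] is taken when [v] is isolated in [S], where no edge constrains it. *)
pose pv := odflt v [pick u in S | adj G v u].
have pvP u : u \in S -> adj G v u -> pv = u.
  move=> uS vu; rewrite /pv; case: pickP => [w /andP[wS vw]|/(_ u)] /=.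
    exact: leafv.
  by rewrite uS vu.
exists (fun u => if u == v then pv else par u) => u w uS wS uw.
have [uv|nuv] := eqVneq u v; first by left; apply: pvP; rewrite -?uv.
have [wv|nwv] := eqVneq w v; first by right; apply: pvP; rewrite -?wv// adj_sym.
by apply: parP; rewrite ?finset.in_setD1 ?nuv ?nwv.
Qed.

End ForestParent.

(** * Upper bound on the expected number of colors of a forest *)

Section ForestUpperBound.
Variables (V : finType) (G : sgraph V) (par : V -> V).
Hypothesis parP : forall u v, adj G u v -> par u = v \/ par v = u.
Implicit Types (s : seq V) (u v w : V).

Definition rising s r u := sorted (before s) (traject par u r).

Lemma rising_le s r r' u : (r <= r')%N -> rising s r' u -> rising s r u.
Proof.
move=> rr'; rewrite /rising -(subnKC rr') -[r in traject _ _ r]addnC.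
rewrite /rising => /(take_sorted r); rewrite take_traject//; exact: leq_addl.
Qed.

Lemma rising_child s r u w :
  par w = u -> before s w u -> rising s r u -> rising s r.+1 w.
Proof. by move=> pw wu; case: r => //= r; rewrite /rising /= pw wu. Qed.

(* Walking down from [u] through earlier children of colors [c - 1], [c - 2],
   ... meets [c] vertices; all but the first [K - r] of them are at the bottom
   of a rising path of [K] vertices. *)
Lemma rising_seq s K r u : uniq s -> u \in s ->
  (forall w, adj G u w -> before s w u -> par w = u) ->
  rising s r u ->
  exists l : seq V, [/\ uniq l, all (rising s K) l,
    all (fun y => first_fit G s y <= first_fit G s u)%N l &
    (first_fit G s u + minn r K <= size l + K)%N].
Proof.
move=> us; move E : (first_fit G s u) => c.
elim: c => [|c IHc] in u r E *.
  by exists [::]; split; rewrite // add0n; apply: geq_minr.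
move=> uin children ru.
have [_ _ below] := first_fit_spec G us uin.
(* Stepping to an earlier child of color [c] lengthens the rising path by one vertex, hence [r.+1].
   For [c = 0] the walk has ended. *)
have [l [ul lK lc szl]] : exists l : seq V, [/\ uniq l, all (rising s K) l,
    all (fun y => first_fit G s y <= c)%N l &
    (c + minn r.+1 K <= size l + K)%N].
  have [->|c0] := posnP c; first by exists [::]; split; rewrite // geq_minr.
  have [|w [uw wu cw]] := below c; first by rewrite E c0 /=.
  have rw := rising_child (children w uw wu) wu ru.
  apply: (IHc w) => //; first exact: before_mem wu.
  (* If [y] were the parent of [w] it would be [u], which is presented after [w]. *)
  move=> y wy yw; have [py|//] := parP wy.
  have pw := children w uw wu; move: yw wu; rewrite -py pw.
  by rewrite /before => /ltnW; rewrite leqNgt => /negbTE ->.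
(* Colors in [l] are at most [c] while [u] has color [c.+1], so adding [u] keeps the list free of
   repetitions. *)
have [rKu|nrKu] := boolP (rising s K u).
  exists (u :: l); split=> /=; last by move: szl; rewrite /minn; do 2 case: ifP; lia.
  - rewrite ul andbT; apply/negP => /(allP lc); by rewrite E ltnn.
  - by rewrite rKu.
  - by rewrite E leqnn /=; apply: sub_all lc => y; apply: leqW.
have rK : (r < K)%N.
  by rewrite ltnNge; apply: contra nrKu => /rising_le; apply.
exists l; split=> //; first by apply: sub_all lc => y; apply: leqW.
by move: szl; rewrite /minn; do 2 case: ifP; lia.
Qed.

Lemma first_fit_le_rising s K v : uniq s -> v \in s -> (1 < K)%N ->
  (first_fit G s v <= K + count (rising s K) (enum V))%N.
Proof.
move=> us vs K1.
suff [l [ul lK lc]] : exists l : seq V,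
    [/\ uniq l, all (rising s K) l & (first_fit G s v <= K + size l)%N].
  apply: leq_trans lc _; rewrite leq_add2l -size_filter; apply: uniq_leq_size => //.
  by move=> y yl; rewrite mem_filter mem_enum (allP lK).
have [le2|gt2] := leqP (first_fit G s v) 2.
  by exists [::]; split; rewrite // addn0 (leq_trans le2).
have [_ _ below] := first_fit_spec G us vs.
case: (pselect (forall w, adj G v w -> before s w v -> par w = v)) => [children|].
  have [//|l [ul lK _ szl]] := @rising_seq s K 1 v us vs children.
  exists l; split=> //; move: szl; rewrite /minn; case: ifP; lia.
move=> /existsNP[p /not_implyP[vp /not_implyP[pv pp]]].
have parv : par v = p by have [] := parP vp.
(* Here the parent [p] precedes [v]. Of two earlier neighbors with the next two lower colors, at
   most one is [p], so some child [w] loses at most 2 colors. The walk then starts with the rising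
   path [w], [v], whose length 2 offsets this loss as [1 < K]. *)
have [w [vw wv wp cw]] : exists w, [/\ adj G v w, before s w v, w <> p &
    (first_fit G s v <= (first_fit G s w).+2)%N].
  have [|w1 [vw1 w1v c1]] := below (first_fit G s v).-1; first by lia.
  have [|w2 [vw2 w2v c2]] := below (first_fit G s v).-2; first by lia.
  have [w1p|nw1p] := pselect (w1 = p).
    exists w2; split=> //; last by lia.
    by move=> w2p; move: c1 c2; rewrite w1p w2p; lia.
  by exists w1; split=> //; lia.
have pw : par w = v by have [|//] := parP vw; rewrite parv => /esym.
have [|||l [ul lK _ szl]] := @rising_seq s K 2 w us _ _ _.
- exact: before_mem wv.
- move=> y wy yw; have [py|//] := parP wy.
  move: yw wv; rewrite -py pw.
  by rewrite /before => /ltnW; rewrite leqNgt => /negbTE ->.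
- exact: rising_child pw wv _.
exists l; split=> //; move: szl; rewrite /minn; case: ifP; lia.
Qed.

Lemma chi_FF_le_rising s K : uniq s -> (1 < K)%N ->
  (chi_FF G s <= K + count (rising s K) (enum V))%N.
Proof.
move=> us K1; rewrite /chi_FF -[leqRHS](size_iota 1).
apply: uniq_leq_size; first exact: undup_uniq.
move=> c; rewrite mem_undup => /mapP[v vs ->]; rewrite mem_iota add1n ltnS.
by rewrite first_fit_le_rising//; have [->] := first_fit_spec G us vs.
Qed.

(** The upward path from [u] does not depend on the order, so [count_sorted_before] bounds the
    probability that it is rising; summing over [u] is linearity of expectation. *)
Lemma sum_rising K :
  (K`! * \sum_(s <- permutations (enum V)) count (rising s K) (enum V)
     <= #|V| * #|V| `!)%N.
Proof.
under eq_bigr do rewrite -sum1_count big_mkcond /=.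
rewrite exchange_big /= big_distrr /= [X in (_ <= X * _)%N]cardE -sum1_size.
rewrite big_distrl /=; apply: leq_sum => u _; rewrite mul1n -big_mkcond sum1_count.
by have := count_sorted_before (traject par u K); rewrite size_traject.
Qed.

Lemma sum_chi_FF_le K : (1 < K)%N ->
  (K`! * \sum_(s <- permutations (enum V)) chi_FF G s
     <= (K`! * K + #|V|) * #|V| `!)%N.
Proof.
move=> K1; apply: (@leq_trans (K`! *
    \sum_(s <- permutations (enum V)) (K + count (rising s K) (enum V)))%N).
  rewrite leq_mul2l; apply/orP; right; rewrite big_seq_cond [leqRHS]big_seq_cond.
  apply: leq_sum => s /andP[]; rewrite mem_permutations => sV _.
  by apply: chi_FF_le_rising; rewrite // (perm_uniq sV) enum_uniq.
rewrite big_split /= mulnDr mulnDl leq_add ?sum_rising//.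
by rewrite big_const_seq count_predT size_permutations_enum iter_addn_0 mulnA.
Qed.

End ForestUpperBound.

(** * From expected colors to the ratio with the chromatic number *)

Lemma chi_gt0 (V : finType) (G : sgraph V) : (0 < #|V|)%N -> (0 < chi G)%N.
Proof.
move=> /card_gt0P[v _]; rewrite /chi; case: ex_minnP => -[|//] /existsP[f _] _.
by case: (f v).
Qed.

Lemma chi_gt1 (V : finType) (G : sgraph V) u v : adj G u v -> (1 < chi G)%N.
Proof.
move=> uv; rewrite /chi; case: ex_minnP => -[|[|//]] /existsP[f].
  by case: (f u).
by move=> /'forall_forallP/(_ u v); rewrite uv !ord1.
Qed.

Lemma chi_FF_edgeless (V : finType) (G : sgraph V) s : uniq s ->
  (forall u v, ~~ adj G u v) -> (chi_FF G s <= 1)%N.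
Proof.
move=> us noedge; rewrite /chi_FF -(size_iota 1 1); apply: uniq_leq_size.
  exact: undup_uniq.
move=> c; rewrite mem_undup => /mapP[v vs ->]; rewrite inE.
have [c0 _ below] := first_fit_spec G us vs.
rewrite eqn_leq c0 andbT leqNgt; apply/negP => c1.
have [|u [vu _ _]] := below 1%N; first by rewrite c1.
by rewrite (negbTE (noedge v u)) in vu.
Qed.

Lemma expected_FF_ratioE (R : realType) (V : finType) (G : sgraph V) :
  expected_FF_ratio R G =
  (\sum_(s <- permutations (enum V)) chi_FF G s)%:R / (#|V| `!)%:R / (chi G)%:R.
Proof. by rewrite /expected_FF_ratio -mulr_suml natr_sum mulrAC. Qed.

(** An edge forces [2 <= chi G], the source of the factor 1/2, and at most [K + 1] colors are
    expected. Without edges First-Fit uses at most one color, and the ratio is at most 1. *)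
Lemma expected_FF_ratio_le (R : realType) (V : finType) (G : sgraph V) K :
  forest G -> (1 < K)%N -> (#|V| <= K`!)%N ->
  expected_FF_ratio R G <= (K.+1)%:R / 2.
Proof.
move=> forestG K1 VK; rewrite expected_FF_ratioE.
have f0 m : 0 < (m`!)%:R :> R by rewrite ltr0n fact_gt0.
have [[u [v uv]]|noedge] := pselect (exists u v, adj G u v).
  have [par parP] := forest_parent forestG.
  have cle : 2 <= (chi G)%:R :> R by rewrite ler_nat; apply: chi_gt1 uv.
  apply: ler_pM; rewrite ?divr_ge0 ?invr_ge0//; last first.
    by rewrite lef_pV2 ?posrE// (lt_le_trans _ cle).
  rewrite ler_pdivrMr// -(ler_pM2l (f0 K)) -!natrM ler_nat.
  apply: leq_trans (sum_chi_FF_le parP K1) _.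
  by rewrite mulnA leq_mul2r mulnS addnC leq_add2r VK orbT.
have [V0|V0] := posnP #|V|.
  rewrite (_ : \sum_(_ <- _) _ = 0)%N ?mul0r ?divr_ge0//.
  have -> : enum V = [::] by apply: size0nil; rewrite -cardE.
  by rewrite /= big_seq1.
apply: (@le_trans _ _ 1); last by rewrite ler_pdivlMr// mul1r ler_nat; lia.
rewrite ler_pdivrMr ?ltr0n ?chi_gt0// mul1r ler_pdivrMr//.
rewrite -natrM ler_nat; apply: (@leq_trans (1 * #|V| `!)%N); last first.
  by rewrite leq_mul2r chi_gt0 ?orbT.
rewrite mul1n -size_permutations_enum -sum1_size big_seq_cond [leqRHS]big_seq_cond.
apply: leq_sum => s /andP[]; rewrite mem_permutations => sV _.
apply: chi_FF_edgeless; first by rewrite (perm_uniq sV) enum_uniq.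
by move=> u v; apply/negP => uv; apply: noedge; exists u, v.
Qed.

Lemma RFF_forest_le (R : realType) n K : (1 < K)%N -> (n <= K`!)%N ->
  RFF R forest n <= (K.+1)%:R / 2.
Proof.
move=> K1 nK; apply: bigmax_le => [|G /asboolP forestG]; first by rewrite divr_ge0.
by apply: expected_FF_ratio_le; rewrite ?card_ord.
Qed.

(** * Graphs from symmetric irreflexive relations *)

Section GraphOfRelation.
Variables (V : finType) (e : rel V).
Hypotheses (e_sym : symmetric e) (e_irr : irreflexive e).

Definition rel_edges : {set {set V}} :=
  [set E | [exists u, exists v, e u v && (E == [set u; v]%SET)]]%SET.

Lemma rel_edges_card2 : [forall E in rel_edges, #|E| == 2%N].
Proof.
apply/forallP => E; apply/implyP; rewrite finset.inE.
move=> /existsP[u /existsP[v /andP[uv /eqP->]]]; rewrite cards2.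
by rewrite (_ : u != v)//; apply: contraTneq uv => ->; rewrite e_irr.
Qed.

Definition rel_graph : sgraph V := SGraph rel_edges_card2.

Lemma adj_rel_graph u v : adj rel_graph u v = e u v.
Proof.
rewrite /adj /= finset.inE; apply/existsP/idP => [[a /existsP[b]]|uv]; last first.
  by exists u; apply/existsP; exists v; rewrite uv eqxx.
move=> /andP[ab /eqP/setP E].
have := E v; have := E u; have := E b; have := E a.
rewrite !finset.in_set2 !eqxx ?orbT /=.
move=> /orP[]/eqP ea /orP[]/eqP eb _ _; move: ab;
  by rewrite ea eb ?e_irr// e_sym.
Qed.

End GraphOfRelation.

(** * The digit forest and its First-Fit colors *)

Section DigitTree.
Variable m : nat.
Hypothesis m_gt0 : (0 < m)%N.
Local Notation B := m.+1.

(* The position of the lowest nonzero digit of [x] in base [B] (0 if [x = 0]). *)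
Definition low_digit x : nat := (\max_(i < x | B ^ i %| x) i)%N.

Definition clear_low x : nat := (x - x %% B ^ (low_digit x).+1)%N.

Lemma low_digit_ge x i : (0 < x)%N -> (B ^ i %| x)%N -> (i <= low_digit x)%N.
Proof.
move=> x0 ix; have ltix : (i < x)%N.
  by apply: leq_trans (dvdn_leq x0 ix); apply: ltn_expl.
exact: (@leq_bigmax_cond _ (fun i : 'I_x => B ^ i %| x)%N val (Ordinal ltix)).
Qed.

Lemma low_digit_eq x i : (0 < x)%N -> (B ^ i %| x)%N -> ~~ (B ^ i.+1 %| x)%N ->
  low_digit x = i.
Proof.
move=> x0 ix nix; apply/eqP; rewrite eqn_leq low_digit_ge// andbT.
apply/bigmax_leqP => j jx; rewrite leqNgt; apply: contra nix => ij.
by apply: dvdn_trans jx; apply: dvdn_exp2l.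
Qed.

Lemma dvdn_clear_low x : (B ^ (low_digit x).+1 %| clear_low x)%N.
Proof.
by rewrite /clear_low {2}(divn_eq x (B ^ (low_digit x).+1)) addnK dvdn_mull.
Qed.

Lemma clear_low_lt x : (0 < x)%N -> (clear_low x < x)%N.
Proof.
move=> x0; rewrite /clear_low ltn_subrL x0 andbT lt0n.
by apply/negP => /(low_digit_ge x0); rewrite ltnn.
Qed.

Lemma low_digit_clear x : (0 < clear_low x)%N ->
  (low_digit x < low_digit (clear_low x))%N.
Proof. by move=> /low_digit_ge; apply; apply: dvdn_clear_low. Qed.

(** This describes the children of [x]: a nonzero digit is written at a position below all nonzero
    digits of [x]. *)
Lemma add_digit x i j : (B ^ i.+1 %| x)%N -> (0 < j < B)%N ->
  low_digit (x + j * B ^ i) = i /\ clear_low (x + j * B ^ i) = x.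
Proof.
move=> ix /andP[j0 jB]; have Bi : (0 < B ^ i)%N by rewrite expn_gt0.
have low : low_digit (x + j * B ^ i) = i.
  apply: low_digit_eq; first by rewrite addn_gt0 muln_gt0 j0 Bi orbT.
    by rewrite dvdn_add ?dvdn_mull// (dvdn_trans _ ix)// dvdn_exp2l.
  rewrite dvdn_addr// expnS dvdn_pmul2r//; apply/negP => /(dvdn_leq j0).
  by rewrite leqNgt jB.
split=> //; rewrite /clear_low low -modnDml (eqP ix) add0n modn_small ?addnK//.
by rewrite expnS ltn_pmul2r.
Qed.

(** This is the parity of the depth, definable by induction because parents are smaller numbers. *)
Lemma clear_low_coloring N :
  exists f : nat -> bool, forall x, (0 < x < N)%N -> f x != f (clear_low x).
Proof.
elim: N => [|N [f fP]]; first by exists xpredT => x; rewrite ltn0 andbF.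
exists (fun x => if x == N then ~~ f (clear_low N) else f x) => x /andP[x0].
have cx := clear_low_lt x0; rewrite ltnS leq_eqVlt => /predU1P[xN|xN].
  by rewrite -xN eqxx (ltn_eqF cx); case: (f _).
have := fP x; rewrite x0 xN => /(_ isT) fx.
by rewrite !ltn_eqF// (ltn_trans cx).
Qed.

Section Ordinal.
Variable n : nat.

(** Requiring a positive parent isolates 0, so the numbers with a single nonzero digit become
    roots. *)
Definition digit_rel : rel 'I_n := fun u v =>
  (clear_low u == v) && (0 < v)%N || (clear_low v == u) && (0 < u)%N.

Lemma digit_rel_sym : symmetric digit_rel.
Proof. by move=> u v; rewrite /digit_rel orbC. Qed.

Lemma digit_rel_irr : irreflexive digit_rel.
Proof.
move=> u; rewrite /digit_rel orbb; apply/negP => /andP[/eqP E u0].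
by have := clear_low_lt u0; rewrite E ltnn.
Qed.

Definition digit_graph : sgraph 'I_n := rel_graph digit_rel_irr.

Lemma adj_digit u v : adj digit_graph u v = digit_rel u v.
Proof. exact: adj_rel_graph digit_rel_sym digit_rel_irr u v. Qed.

Lemma digit_smaller u v : digit_rel u v -> (v <= u)%N -> val v = clear_low u.
Proof.
case/orP=> /andP[/eqP //] E u0 vu; have := vu; rewrite leqNgt -E clear_low_lt//.
by rewrite lt0n; apply: contraTneq u0 => v0; rewrite -E v0 /clear_low sub0n.
Qed.

(** The largest vertex of a cycle would have two distinct smaller neighbors, but its only smaller
    neighbor is its parent. *)
Lemma digit_forest : forest digit_graph.
Proof.
move=> c c2 /andP[cyc uc].
have [x0 x0c] : exists x, x \in c by case: c c2 {cyc uc} => // x c _; exists x; rewrite mem_head.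
have [x xc xmax] := @arg_maxnP _ x0 (mem c) val x0c.
have [i p E] := rot_to xc.
have pc y : y \in p -> y \in c.
  by move=> yp; rewrite -(mem_rot i) E inE yp orbT.
move: cyc uc c2; rewrite -(rot_cycle i) -(rot_uniq i) -(size_rot i) E.
case/lastP: p => [//|p b] in pc {E} *; case: p => [//|a p] in pc *.
set p' := rcons (a :: p) b in pc *.
rewrite (cycle_path x) [last _ _]/= last_rcons /= => /and3P[bx xa _].
move=> /and3P[_ + _] _; rewrite mem_rcons inE negb_or => /andP[/eqP nab _].
move: bx; rewrite adj_sym => xb; apply: nab; apply: val_inj.
rewrite !adj_digit in xa xb.
have le_x y : y \in p' -> (y <= x)%N by move=> yp; apply: xmax; apply: pc.
have -> : val a = clear_low x.
  by apply: (digit_smaller xa); apply: le_x; rewrite mem_head.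
by apply/esym/(digit_smaller xb)/le_x; rewrite inE mem_rcons mem_head orbT.
Qed.

Lemma chi_digit : (chi digit_graph <= 2)%N.
Proof.
rewrite /chi; case: ex_minnP => c _; apply; apply/existsP.
have [f fP] := clear_low_coloring n.
exists [ffun u : 'I_n => if f u then ord0 else ord_max].
apply/forallP => u; apply/forallP => v; apply/implyP; rewrite adj_digit !ffunE.
have main (a b : 'I_n) : clear_low a = b -> (0 < b)%N -> f a != f b.
  move=> <- b0; apply: fP; rewrite ltn_ord andbT lt0n.
  by apply: contraTneq b0 => ->; rewrite /clear_low sub0n.
suff h : digit_rel u v -> f u != f v by move=> /h; case: (f u); case: (f v).
by case/orP => /andP[/eqP E h]; [|rewrite eq_sym]; apply: main.
Qed.

Section Windows.
Variable w : nat -> nat.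

(* [windows k x]: for every [i < k] some child of [x] with lowest digit at
   position [i] lies in window [i] and, recursively, will be colored [i.+1]. *)
Fixpoint windows k x : bool :=
  if k is i.+1 then
    windows i x && [exists j : 'I_m, let y := (x + j.+1 * B ^ i)%N in
                     (w y == i) && windows i y]
  else true.

Lemma windowsP k x i : windows k x -> (i < k)%N -> exists j,
  let y := (x + j * B ^ i)%N in [/\ (0 < j < B)%N, w y = i & windows i y].
Proof.
elim: k => [//|k IHk] /= /andP[wk /existsP[j /andP[/eqP wj hj]]].
rewrite ltnS leq_eqVlt => /predU1P[->|]; last exact: IHk.
by exists j.+1; split=> //=; rewrite ltnS.
Qed.

Variable s : seq 'I_n.
Hypotheses (us : uniq s) (ms : forall u, u \in s).
Hypothesis sw : forall u v : 'I_n, (w u < w v)%N -> before s u v.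
Local Notation col := (first_fit digit_graph s).

Definition precedes_parent (u : 'I_n) :=
  forall v : 'I_n, clear_low u = v -> (0 < v)%N -> before s u v.

Lemma earlier_child (u v : 'I_n) : precedes_parent u ->
  digit_rel u v -> before s v u -> clear_low v = u /\ (0 < u)%N.
Proof.
move=> pu /orP[] /andP[/eqP uv h] // vu; have := pu v uv h; move: vu.
by rewrite /before => /ltnW; rewrite leqNgt => /negbTE->.
Qed.

Lemma precedes_parentI (u v : 'I_n) : clear_low u = v -> before s u v ->
  precedes_parent u.
Proof. by move=> uv buv v'; rewrite uv => /val_inj <-. Qed.

(** Only children of [u] are earlier neighbors, and their lowest nonzero digits sit at smaller
    positions, so induction bounds their colors. *)
Lemma col_le (u : 'I_n) : precedes_parent u -> (col u <= (low_digit u).+1)%N.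
Proof.
move E : (low_digit u) => k; elim/ltn_ind: k => k IHk in u E *.
move=> pu; have [_ _ below] := first_fit_spec digit_graph us (ms u).
have [le1|gt1] := leqP (col u) 1; first exact: leq_trans le1 _.
have [|v [uv vu cv]] := below (col u).-1; first by lia.
rewrite adj_digit in uv; have [pv u0] := earlier_child pu uv vu.
have lt : (low_digit v < k)%N by rewrite -E -pv low_digit_clear// pv.
have := IHk _ lt v erefl (precedes_parentI pv vu).
by rewrite cv; lia.
Qed.

(** If [u] had a color [i.+1] with [i < k], the child supplied by [windows] for [i] would have that
    same color by induction and, lying in an earlier window, would precede [u]. *)
Lemma col_windows (u : 'I_n) k : (0 < u)%N -> low_digit u = k -> w u = k ->
  windows k u -> (u + B ^ k <= n)%N -> (B ^ k %| u)%N -> precedes_parent u ->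
  col u = k.+1.
Proof.
elim/ltn_ind: k => k IHk in u *; move=> u0 lu wu hu un ku pu.
apply/eqP; rewrite eqn_leq -{1}lu col_le//= ltnNge; apply/negP => cuk.
have [c0 c1 _] := first_fit_spec digit_graph us (ms u).
have [|j [jB wy hy]] := windowsP (i := (col u).-1) hu; first by lia.
set i := (col u).-1 in wy hy; have ik : (i < k)%N by rewrite /i; lia.
have iu : (B ^ i.+1 %| u)%N by apply: dvdn_trans ku; apply: dvdn_exp2l.
have [ly py] := add_digit iu jB.
set y := (u + j * B ^ i)%N in wy hy ly py.
(* The block of [B ^ i] numbers starting at [y] lies inside that of [u], so all descendants involved
   are vertices. *)
have yn : (y + B ^ i <= n)%N.
  apply: leq_trans un; rewrite /y -addnA leq_add2l -mulSnr.
  apply: (@leq_trans (B ^ i.+1)); last by rewrite leq_exp2l.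
  by rewrite expnS leq_mul2r; case/andP: jB => _ ->; rewrite orbT.
have Bi : (0 < B ^ i)%N by rewrite expn_gt0.
have yltn : (y < n)%N by apply: leq_trans yn; lia.
pose v := Ordinal yltn.
have vu : before s v u by apply: sw; rewrite /= wy wu.
have cv : col v = i.+1.
  apply: (IHk i ik) => //=; first by rewrite /y; lia.
    by rewrite dvdn_add ?dvdn_mull// (dvdn_trans _ iu)// dvdn_exp2l.
  exact: (@precedes_parentI v u py vu).
have := c1 v; rewrite adj_digit /digit_rel /= py eqxx u0 orbT cv => /(_ isT vu).
by rewrite /i; lia.
Qed.

(** Here 0 acts as a virtual vertex above all roots: [windows K 0] supplies a root of each color
    from 1 to [K]. *)
Lemma chi_FF_windows K : (B ^ K <= n)%N -> windows K 0 ->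
  (K <= chi_FF digit_graph s)%N.
Proof.
move=> Kn h0; rewrite /chi_FF -[leqLHS](size_iota 1).
apply: uniq_leq_size; first exact: iota_uniq.
move=> c; rewrite mem_iota add1n ltnS => /andP[c0 cK]; rewrite mem_undup.
have [|j [jB wy hy]] := windowsP (i := c.-1) h0; first by lia.
set i := c.-1 in wy hy; rewrite add0n in wy hy.
have [ly py] := @add_digit 0 i j (dvdn0 _) jB; rewrite !add0n in ly py.
set y := (j * B ^ i)%N in wy hy ly py.
have yn : (y + B ^ i <= n)%N.
  apply: leq_trans Kn; rewrite /y -mulSnr.
  apply: (@leq_trans (B ^ i.+1)); last by rewrite leq_exp2l// /i; lia.
  by rewrite expnS leq_mul2r; case/andP: jB => _ ->; rewrite orbT.
have Bi : (0 < B ^ i)%N by rewrite expn_gt0.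
have yltn : (y < n)%N by apply: leq_trans yn; lia.
apply/mapP; exists (Ordinal yltn) => //.
rewrite (@col_windows (Ordinal yltn) i) //=; first by rewrite /i; lia.
- by rewrite muln_gt0 Bi; case/andP: jB => ->.
- by rewrite dvdn_mull.
- by move=> v; rewrite py => <-.
Qed.

End Windows.
End Ordinal.
End DigitTree.

(** * Sorting a random order by random windows *)

Section RandomWindows.
Variables (V : finType) (K : nat).
Implicit Types (w : {ffun V -> 'I_K}) (s : seq V).

Definition window_sort w s := sort (fun u v => w u <= w v)%N s.

Lemma perm_window_sort w s : perm_eq (window_sort w s) s.
Proof. by rewrite /window_sort perm_sort. Qed.

Lemma window_sort_before w s u v : u \in s -> v \in s ->
  (w u < w v)%N -> before (window_sort w s) u v.
Proof.
move=> us vs; apply: contraTT; rewrite /before -!leqNgt /window_sort.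
set le := fun u v => (w u <= w v)%N.
have le_trans : transitive le by move=> ? ? ?; apply: leq_trans.
have le_refl : reflexive le by move=> ?; apply: leqnn.
have sorted_s : sorted le (sort le s).
  by apply: sort_sorted => ? ?; apply: leq_total.
by apply: (sorted_leq_index le_trans le_refl sorted_s); rewrite mem_sort.
Qed.

(* Sorting a uniformly random order by independent uniform labels gives a
   uniformly random order: relabelling the vertices acts freely. *)
Lemma sum_window_sort (R : nmodType) (F : seq V -> R) :
  \sum_w \sum_(s <- permutations (enum V)) F (window_sort w s)
    = (\sum_(s <- permutations (enum V)) F s) *+ #|{ffun V -> 'I_K}|.
Proof.
under eq_bigr do rewrite (@sum_permutationsE _ _ _ (enum V))//.
rewrite exchange_big /=.
transitivity (\sum_(sigma : {perm V}) \sum_w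
    F (map sigma (window_sort w (enum V)))).
  apply: eq_bigr => sigma _.
  (* Transporting the labels along [sigma] makes sorting commute with relabelling by [sigma]. *)
  pose h w : {ffun V -> 'I_K} := [ffun u => w ((sigma^-1)%g u)].
  have hinj : injective h.
    move=> w w' /ffunP e; apply/ffunP => u.
    by have := e (sigma u); rewrite !ffunE permK.
  rewrite (reindex_inj hinj); apply: eq_bigr => w _.
  rewrite /window_sort sort_map; congr (F (map _ (sort _ _))).
  by apply/funext => u; apply/funext => v; rewrite /= !ffunE !permK.
rewrite exchange_big /= -sumr_const; apply: eq_bigr => w _.
by rewrite (sum_permutationsE _ (perm_window_sort w (enum V))).
Qed.

End RandomWindows.

(** * Probability that all required windows are hit *)

Section WindowProbability.
Variables (R : realType) (n K : nat).
Hypothesis K_gt0 : (0 < K)%N.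
Local Notation W := {ffun 'I_n -> 'I_K}.

Definition extend (w : W) (x : nat) : nat :=
  if insub x is Some u then val (w u) else 0%N.

Lemma extend_val w (u : 'I_n) : extend w u = w u.
Proof. by rewrite /extend valK. Qed.

Definition Pr (E : (nat -> nat) -> bool) : R :=
  (\sum_(w : W) (E (extend w))%:R) / #|W|%:R.

Lemma card_W_gt0 : 0 < #|W|%:R :> R.
Proof. by rewrite ltr0n card_ffun !card_ord expn_gt0 K_gt0. Qed.

Lemma Pr_ge0 E : 0 <= Pr E.
Proof. by rewrite divr_ge0 ?sumr_ge0. Qed.

Lemma le_Pr (E F : (nat -> nat) -> bool) :
  (forall f, E f -> F f) -> Pr E <= Pr F.
Proof.
move=> EF; rewrite ler_pM2r ?invr_gt0 ?card_W_gt0//; apply: ler_sum => w _.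
by rewrite ler_nat; case: (E _) (EF (extend w)) => // ->.
Qed.

Lemma Pr_not E : Pr (fun f => ~~ E f) = 1 - Pr E.
Proof.
apply/eqP; rewrite eq_sym subr_eq -mulrDl -big_split /=.
rewrite (eq_bigr (fun=> 1)) => [|w _]; last by case: (E _); rewrite ?addr0 ?add0r.
by rewrite sumr_const -[#|_|]/#|W| divff// gt_eqF// card_W_gt0.
Qed.

Lemma Pr_or E F : Pr (fun f => E f || F f) <= Pr E + Pr F.
Proof.
rewrite -mulrDl ler_pM2r ?invr_gt0 ?card_W_gt0// -big_split /=.
by apply: ler_sum => w _; rewrite -natrD ler_nat; case: (E _); case: (F _).
Qed.

Definition depends (a b : nat) (E : (nat -> nat) -> bool) :=
  forall f g, (forall x, (a <= x < b)%N -> f x = g x) -> E f = E g.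

(* Exchanging the parts above [b] of two independent labellings preserves
   the uniform distribution on pairs of labellings. *)
Lemma Pr_and a b c E F : depends a b E -> depends b c F ->
  Pr (fun f => E f && F f) = Pr E * Pr F.
Proof.
move=> dE dF; pose mix (p q : W) : W := [ffun u : 'I_n => if (u < b)%N then p u else q u].
pose phi (pq : W * W) := (mix pq.1 pq.2, mix pq.2 pq.1).
have phiK : involutive phi.
  have mixK p q : mix (mix p q) (mix q p) = p.
    by apply/ffunP => u; rewrite !ffunE; case: (boolP (u < b)%N).
  by move=> [p q]; rewrite /phi /= !mixK.
have mixE p q : E (extend (mix p q)) = E (extend p).
  apply: dE => x /andP[_ xb]; rewrite /extend; case: insubP => // u _ ux.
  by rewrite ffunE ux xb.
have mixF p q : F (extend (mix p q)) = F (extend q).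
  apply: dF => x /andP[bx _]; rewrite /extend; case: insubP => // u _ ux.
  by rewrite ffunE ux ltnNge bx.
rewrite /Pr mulrACA -invfM.
have -> : (\sum_(w : W) (E (extend w))%:R) * (\sum_(w : W) (F (extend w))%:R)
    = (\sum_(w : W) (E (extend w) && F (extend w))%:R) * #|W|%:R :> R.
  rewrite big_distrlr /= pair_big /= mulr_natr.
  transitivity (\sum_(pq : W * W) (E (extend pq.1) && F (extend pq.1))%:R : R).
    rewrite [RHS](reindex_inj (inv_inj phiK)); apply: eq_bigr => pq _.
    by rewrite /= mixE mixF; case: (E _); rewrite ?mul0r ?mul1r.
  rewrite -(pair_big xpredT xpredT
     (fun p _ : W => (E (extend p) && F (extend p))%:R : R)) /= -sumrMnl.
  by apply: eq_bigr => w _; rewrite sumr_const.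
by rewrite -mulf_div divff ?mulr1// gt_eqF// card_W_gt0.
Qed.

Lemma Pr_label x k : (x < n)%N -> (k < K)%N ->
  Pr (fun f => f x == k) = K%:R^-1.
Proof.
move=> xn kK; pose y := Ordinal xn; pose i := Ordinal kK.
(* The indicator is a product over vertices with one nontrivial factor, so its sum over labellings
   factors as well. *)
pose g (u : 'I_n) (a : 'I_K) : R := if u == y then (a == i)%:R else 1.
have : \prod_u \sum_a g u a = \sum_(w : W) \prod_u g u (w u).
  by rewrite bigA_distr_bigA.
rewrite (bigD1 y)//= {1}/g eqxx (bigD1 i)//= eqxx big1 ?addr0 => [|a /negbTE->//]; rewrite mul1r.
rewrite (eq_bigr (fun=> K%:R)) => [|u /negbTE uy]; last first.
  rewrite (eq_bigr (fun=> 1)) => [|a _]; last by rewrite /g uy.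
  by rewrite sumr_const card_ord.
rewrite prodr_const => gK.
rewrite /Pr (eq_bigr (fun w : W => \prod_(u < n) g u (w u))) => [|w _]; last first.
  rewrite (bigD1 y)//= big1 => [|u /negbTE uy]; last by rewrite /g uy.
  rewrite mulr1 /g eqxx; congr (_ %:R); congr nat_of_bool.
  by rewrite -[x in extend w x]/(val y) extend_val.
rewrite -gK card_ffun !card_ord natrX.
have -> : #|[pred u | u != y]| = n.-1 by have := cardC1 y; rewrite card_ord.
have -> : K%:R ^+ n = K%:R ^+ n.-1.+1 :> R by rewrite prednK// (leq_trans _ xn).
by rewrite exprS invfM mulrCA divff ?mulr1// expf_neq0// gt_eqF// ltr0n.
Qed.

Variable m : nat.
Local Notation B := m.+1.

(** The descendants consulted fill at most the block of [x]; the label of [x] itself is not read,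
    hence the left end [x.+1]. *)
Lemma depends_windows k x :
  depends x.+1 (x + B ^ k) (fun f => windows m f k x).
Proof.
elim: k => [//|k IHk] /= in x * => f g fg.
have Bk : (0 < B ^ k)%N by rewrite expn_gt0.
have sub y : (x <= y)%N -> (y + B ^ k <= x + B ^ k.+1)%N ->
    windows m f k y = windows m g k y.
  by move=> xy yB; apply: IHk => z /andP[yz zy]; apply: fg; lia.
congr andb.
  by apply: sub => //; rewrite leq_add2l leq_pexp2l.
apply: eq_existsb => j.
have jB : ((j.+1 * B ^ k) + B ^ k <= B ^ k.+1)%N.
  by rewrite -mulSnr expnS leq_mul2r ltnS ltn_ord orbT.
have jB0 : (0 < j.+1 * B ^ k)%N by rewrite muln_gt0.
rewrite fg; first by congr andb; apply: sub; lia.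
by lia.
Qed.

Local Notation q := ((1 - (2 * K%:R)^-1) ^+ m : R).

(** A child at a given position hits its window with probability 1/K and by induction succeeds
    recursively with probability at least 1/2. The [m] children there are independent, so all fail
    with probability at most [q]; a union bound over the positions gives the factor [k]. *)
Lemma Pr_windows k x : K%:R * q <= 2^-1 -> (k <= K)%N -> (x + B ^ k <= n)%N ->
  Pr (fun f => ~~ windows m f k x) <= k%:R * q.
Proof.
move=> Kq; elim: k => [|k IHk] in x *.
  by move=> _ _; rewrite Pr_not mul0r /Pr sumr_const -[#|_|]/#|W| divff ?subrr// gt_eqF// card_W_gt0.
move=> kK xn; have K0 : 0 < K%:R :> R by rewrite ltr0n.
have Bk : (0 < B ^ k)%N by rewrite expn_gt0.
have q0 : 0 <= 1 - (2 * K%:R)^-1 :> R.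
  rewrite subr_ge0 invf_le1 ?mulr_gt0//.
  by rewrite -natrM ler1n muln_gt0.
pose E j f := let y := (x + j.+1 * B ^ k)%N in (f y == k) && windows m f k y.
have PE j : (j < m)%N -> (2 * K%:R)^-1 <= Pr (E j).
  move=> jm; pose y := (x + j.+1 * B ^ k)%N.
  have yn : (y + B ^ k <= n)%N.
    apply: leq_trans xn; rewrite /y -addnA leq_add2l -mulSnr expnS.
    by rewrite leq_mul2r ltnS jm orbT.
  have yltn : (y < n)%N by apply: leq_trans yn; rewrite -addn1 leq_add2l.
  have dy : depends y y.+1 (fun f => f y == k).
    by move=> f g fg; rewrite fg// leqnn ltnSn.
  have -> : Pr (E j) = Pr (fun f => f y == k) * Pr (fun f => windows m f k y).
    exact: Pr_and dy (@depends_windows k y).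
  rewrite (Pr_label yltn kK).
  rewrite invfM mulrC ler_pM2l ?invr_gt0//.
  have := IHk y (ltnW kK) yn; rewrite Pr_not lerBlDr => h.
  have : k%:R * q <= 2^-1 :> R.
    apply: le_trans Kq; rewrite ler_wpM2r ?exprn_ge0// ler_nat; exact: ltnW.
  by move: h; lra.
(* The children occupy consecutive disjoint blocks of length [B ^ k], which lets [Pr_and] split off
   one child at a time. *)
have dA r : depends (x + B ^ k) (x + r.+1 * B ^ k)
    (fun f => all (fun j => ~~ E j f) (iota 0 r)).
  move=> f g fg; apply: eq_in_all => j; rewrite mem_iota /= add0n => jr.
  have j1 : (B ^ k <= j.+1 * B ^ k)%N by rewrite leq_pmull.
  have j2 : (j.+1 * B ^ k + B ^ k <= r.+1 * B ^ k)%N.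
    by rewrite -mulSnr leq_mul2r ltnS jr orbT.
  rewrite /E fg; last by lia.
  congr (~~ (_ && _)); apply: depends_windows => z zj; apply: fg; lia.
have PA r : (r <= m)%N ->
    Pr (fun f => all (fun j => ~~ E j f) (iota 0 r)) <= (1 - (2 * K%:R)^-1) ^+ r.
  elim: r => [_|r IHr rm].
    rewrite expr0 /Pr /= sumr_const -[#|_|]/#|W| divff// gt_eqF// card_W_gt0//.
  apply: (@le_trans _ _ (Pr (fun f => all (fun j => ~~ E j f) (iota 0 r) && ~~ E r f))).
    by apply: le_Pr => f; rewrite -addn1 iotaD all_cat /= add0n andbT.
  rewrite (Pr_and (dA r) (c := (x + r.+2 * B ^ k)%N)) => [|f g fg]; last first.
    have r2 : (r.+2 * B ^ k = r.+1 * B ^ k + B ^ k)%N by rewrite mulSnr.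
    rewrite /E fg; last by lia.
    congr (~~ (_ && _)); apply: depends_windows => z zj; apply: fg; lia.
  rewrite exprSr; apply: ler_pM; rewrite ?Pr_ge0 ?IHr 1?ltnW//.
  by rewrite Pr_not lerD2l lerN2 PE.
rewrite -natr1 mulrDl mul1r.
apply: le_trans (lerD (IHk x (ltnW kK) _) (PA m (leqnn m))); last first.
  by apply: leq_trans xn; rewrite leq_add2l leq_pexp2l.
apply: le_trans (Pr_or _ _); apply: le_Pr => f /=.
rewrite negb_and => /orP[->//|]; rewrite negb_exists => /forallP h.
by apply/orP; right; apply/allP => j; rewrite mem_iota /= add0n => jm; exact: (h (Ordinal jm)).
Qed.

End WindowProbability.

(** * Lower bound for the digit forest *)

Section LowerBound.
Variables (R : realType) (n K m : nat).
Hypotheses (K_gt0 : (0 < K)%N) (m_gt0 : (0 < m)%N).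
Local Notation q := ((1 - (2 * K%:R)^-1) ^+ m : R).

Lemma sum_chi_FF_digit : (m.+1 ^ K <= n)%N -> K%:R * q <= 2^-1 ->
  K%:R * (1 - K%:R * q) * (n`!)%:R
    <= (\sum_(s <- permutations (enum 'I_n)) chi_FF (digit_graph m_gt0 n) s)%:R :> R.
Proof.
move=> Kn Kq; have W0 := @card_W_gt0 R n K K_gt0.
rewrite -(ler_pM2r W0) natr_sum [leRHS]mulr_natr -sum_window_sort.
apply: (@le_trans _ _ (\sum_(w : {ffun 'I_n -> 'I_K})
    (K * windows m (extend w) K 0)%:R * (n`!)%:R)); last first.
  apply: ler_sum => w _; rewrite -[X in X`!]card_ord -size_permutations_enum.
  rewrite mulr_natr -sum1_size -sumrMnr big_seq_cond [leRHS]big_seq_cond.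
  apply: ler_sum => s /andP[]; rewrite mem_permutations => sV _.
  rewrite mulr1n ler_nat; case: (boolP (windows _ _ _ _)) => [h|_]; last by rewrite muln0.
  rewrite muln1; apply: chi_FF_windows h => //.
  - by rewrite (perm_uniq (perm_window_sort w s)) (perm_uniq sV) enum_uniq.
  - by move=> u; rewrite (perm_mem (perm_window_sort w s)) (perm_mem sV) mem_enum.
  - move=> u v; rewrite !extend_val; apply: window_sort_before;
    by rewrite (perm_mem sV) mem_enum.
rewrite -mulr_suml mulrAC ler_pM2r ?ltr0n ?fact_gt0//.
under eq_bigr do rewrite natrM.
rewrite -mulr_sumr -mulrA ler_pM2l ?ltr0n// -ler_pdivlMr//.
rewrite -[leRHS]/(Pr R n K (fun f => windows m f K 0)).
have := @Pr_windows R n K K_gt0 m K 0 Kq (leqnn K) Kn.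
by rewrite Pr_not// lerBlDr addrC -lerBlDr.
Qed.

End LowerBound.

Lemma Bernoulli_le (R : realType) (x : R) N : 0 <= x -> 1 + N%:R * x <= (1 + x) ^+ N.
Proof.
move=> x0; elim: N => [|N IHN]; first by rewrite mul0r addr0 expr0.
rewrite exprSr -natr1; apply: le_trans (ler_wpM2r _ IHN); last by lra.
have : 0 <= N%:R * x * x by rewrite !mulr_ge0.
by lra.
Qed.

(** With x = 1/N, the product of (1 - x)^N and (1 + x)^N is at most 1, and the second factor is at
    least 2 by Bernoulli. *)
Lemma expr_one_sub_inv_le (R : realType) N : (0 < N)%N ->
  (1 - N%:R^-1) ^+ N <= 2^-1 :> R.
Proof.
move=> N0; have Nr : 0 < N%:R :> R by rewrite ltr0n.
set x := N%:R^-1; have x0 : 0 < x by rewrite invr_gt0.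
have x1 : x <= 1 by rewrite invf_le1// ler1n.
have h := Bernoulli_le N (ltW x0); rewrite /x divff ?gt_eqF// -/x in h.
have p0 : 0 <= (1 - x) ^+ N by rewrite exprn_ge0// subr_ge0.
have : (1 - x) ^+ N * (1 + x) ^+ N <= 1.
  have xx : 0 <= x * x by rewrite mulr_ge0 ?ltW.
  by rewrite -exprMn exprn_ile1//; [rewrite mulr_ge0//|]; lra.
by move: (ler_wpM2l p0 h); lra.
Qed.

(** With [m = 2 * K * L] the failure bound per position is at most 2^-L. The condition on [2 * K]
    makes the total failure at most 1/2, and that on [K ^ 2] makes the expected loss of colors at
    most 1. *)
Lemma RFF_forest_ge (R : realType) n K L : (0 < K)%N -> (0 < L)%N ->
  (2 * K <= 2 ^ L)%N -> (K ^ 2 <= 2 ^ L)%N -> ((2 * K * L).+1 ^ K <= n)%N ->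
  (K%:R - 1) / 2 <= RFF R forest n.
Proof.
move=> K0 L0 KL K2L Kn; set m := (2 * K * L)%N in Kn.
have m0 : (0 < m)%N by rewrite !muln_gt0 K0 L0.
have n0 : (0 < n)%N by apply: leq_trans Kn; rewrite expn_gt0.
have Kr : 0 < K%:R :> R by rewrite ltr0n.
have qL : (1 - (2 * K%:R)^-1) ^+ m <= (2 ^+ L)^-1 :> R.
  rewrite /m exprM -exprVn lerXn2r ?nnegrE ?invr_ge0 ?exprn_ge0//.
    by rewrite subr_ge0 invf_le1 ?mulr_gt0// -natrM ler1n muln_gt0.
  by rewrite -natrM expr_one_sub_inv_le// muln_gt0.
have L2 : 0 < 2 ^+ L :> R by rewrite exprn_gt0.
have Kq : K%:R * (1 - (2 * K%:R)^-1) ^+ m <= 2^-1 :> R.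
  apply: le_trans (ler_wpM2l (ltW Kr) qL) _; rewrite ler_pdivrMr// mulrC.
  by rewrite ler_pdivlMr// mulrC -natrM -natrX ler_nat.
have K2q : K%:R * (K%:R * (1 - (2 * K%:R)^-1) ^+ m) <= 1 :> R.
  rewrite mulrA; apply: le_trans (ler_wpM2l _ qL) _; first by rewrite mulr_ge0 ?ltW.
  by rewrite ler_pdivrMr// mul1r -natrM -natrX ler_nat mulnn.
have := @sum_chi_FF_digit R n K m K0 m0 Kn Kq.
rewrite -ler_pdivlMr ?ltr0n ?fact_gt0// => h.
apply: le_trans (_ : expected_FF_ratio R (digit_graph m0 n) <= _); last first.
  by apply: le_bigmax_cond; apply/asboolP; apply: digit_forest.
rewrite expected_FF_ratioE card_ord.
have chi0 : 0 < (chi (digit_graph m0 n))%:R :> R.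
  by rewrite ltr0n chi_gt0// card_ord.
have chi2 : (chi (digit_graph m0 n))%:R <= 2 :> R by rewrite ler_nat chi_digit.
apply: (@le_trans _ _ (K%:R * (1 - K%:R * (1 - (2 * K%:R)^-1) ^+ m) / 2)).
  by rewrite ler_pM2r ?invr_gt0// mulrBr mulr1 lerD2l lerN2.
apply: ler_pM => //; rewrite ?invr_ge0//; last by rewrite lef_pV2 ?posrE.
by rewrite mulr_ge0 ?ltW//; lra.
Qed.

(** A weak Stirling bound, by induction from (1 + 1/N)^N <= e. *)
Lemma expn_le_fact_exp (R : realType) N :
  N%:R ^+ N <= (N`!)%:R * expR N%:R :> R.
Proof.
elim: N => [|N IHN]; first by rewrite expr0 fact0 expR0 mulr1.
suff h : N.+1%:R ^+ N <= N%:R ^+ N * expR 1 :> R.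
  rewrite exprS factS natrM -[in expR _]natr1 expRD -mulrA ler_pM2l ?ltr0n//.
  by rewrite mulrA; apply: le_trans h _; rewrite ler_pM2r ?expR_gt0.
have [->|N0] := posnP N; first by rewrite !expr0 mul1r -expR0 ler_expR.
have Nr : 0 < N%:R :> R by rewrite ltr0n.
have -> : N.+1%:R = N%:R * (1 + N%:R^-1) :> R.
  by rewrite mulrDr mulr1 divff ?gt_eqF// natr1.
rewrite exprMn ler_pM2l ?exprn_gt0//.
have -> : expR 1 = expR N%:R^-1 ^+ N :> R by rewrite -expRM_natl divff ?gt_eqF.
by rewrite lerXn2r ?nnegrE ?expR_ge0 ?expR_ge1Dx// addr_ge0 ?invr_ge0.
Qed.

(** * Choice of parameters, with [x], [y], [z] the iterated logarithms of [n] *)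

Section Asymptotics.
Variables (R : realType) (n : nat) (eps x y z : R).
Hypotheses (eps_gt0 : 0 < eps) (eps_le : 2 * eps <= 1).
Hypotheses (nx : expR x = n%:R) (xy : expR y = x) (yz : expR z = y).
Hypothesis z_ge : 100 <= eps ^+ 2 * z.
Local Notation Q := (x / y).

Lemma scales :
  [/\ 100 <= eps * z, 100 <= z, z ^+ 2 / 2 <= y & y ^+ 2 / 2 <= x].
Proof.
move: eps_gt0 eps_le z_ge => e_gt0 e_le ze; have z0 : 0 < z.
  have e2 : 0 < eps ^+ 2 by rewrite exprn_gt0.
  by rewrite -(pmulr_rgt0 _ e2); apply: lt_le_trans z_ge.
have eps1 : eps < 1 by lra.
have ez : eps ^+ 2 * z <= eps * z.
  by rewrite ler_pM2r// expr2 ler_piMr ?ltW.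
have ez1 : eps * z <= z by rewrite ler_piMl ?ltW.
have sq t : 0 <= t -> t ^+ 2 / 2 <= expR t.
  by move=> t0; have := expR_ge1Dxn 1 t0; rewrite (_ : 2`! = 2)%N//; lra.
have y0 : 0 <= y by rewrite -yz expR_ge0.
by split; [lra|lra|rewrite -yz sq ?ltW|rewrite -xy sq].
Qed.

Lemma scales_Q : [/\ 0 < y, 100 * y <= eps ^+ 2 * y ^+ 2, 2 <= eps * Q,
  2 <= Q & Q <= x].
Proof.
move: eps_gt0 eps_le z_ge => e_gt0 e_le ze; have [ez zge yge xge] := scales.
have y0 : 0 < y by rewrite -yz expR_gt0.
have x0 : 0 < x by rewrite -xy expR_gt0.
have zy : z <= y by nra.
have Qy : y / 2 <= Q by rewrite ler_pdivlMr//; nra.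
have e2 : 0 <= eps ^+ 2 by rewrite exprn_ge0 ?ltW.
split=> //; [nra|nra|lra|].
by rewrite ler_pdivrMr// ler_pMr//; lra.
Qed.

Lemma RFF_asymptotic_le : RFF R forest n <= (2^-1 + eps) * Q.
Proof.
move: eps_gt0 eps_le => e_gt0 e_le.
have [ez zge yge xge] := scales; have [y0 _ eQ Q2 _] := scales_Q.
have x0 : 0 < x by rewrite -xy expR_gt0.
pose K := (Num.truncn ((1 + eps) * Q)).+1.
have Qy : Q * y = x by rewrite divfK// gt_eqF.
have : 0 <= (1 + eps) * Q by nra.
move=> /truncn_itv; rewrite -/K -[K%:R]natr1 => /andP[Kle Kgt].
have {Kle} : K%:R <= (1 + eps) * Q + 1 by rewrite /K -natr1 lerD2r.
move: Kgt; rewrite natr1 -/K => Kgt Kle.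
(* Rounding costs at most 1 after halving, absorbed by [2 <= eps * Q]. *)
apply: (@le_trans _ _ (K.+1%:R / 2)); last by rewrite -natr1; nra.
apply: RFF_forest_le.
  by rewrite -(ltr_nat R); apply: lt_trans Kgt; nra.
rewrite -(ler_nat R) -nx -(ler_pM2r (expR_gt0 K%:R)) -expRD.
apply: le_trans (expn_le_fact_exp R K).
have QK : expR (y - z) <= K%:R.
  by rewrite expRD expRN xy yz; apply: ltW; apply: lt_trans Kgt; nra.
apply: (@le_trans _ _ (expR (y - z) ^+ K)); last first.
  by rewrite lerXn2r ?nnegrE ?expR_ge0.
rewrite -expRM_natl ler_expR.
(* Since [y] is at least of order z^2, [eps * y] dominates [z], which covers the losses from ln Q =
   y - z and from Stirling. *)
have h : y <= (1 + eps) * (y - z - 1).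
  have : eps * z * z <= 2 * (eps * y) by nra.
  nra.
have h0 : 0 <= y - z - 1 by nra.
have : x <= K%:R * (y - z - 1); last by lra.
rewrite -[leLHS]Qy; apply: (@le_trans _ _ ((1 + eps) * Q * (y - z - 1))).
  by rewrite [leRHS](_ : _ = Q * ((1 + eps) * (y - z - 1))) ?ler_pM2l//; [lra|ring].
by rewrite ler_wpM2r// ltW.
Qed.

Lemma RFF_asymptotic_ge : (2^-1 - eps) * Q <= RFF R forest n.
Proof.
move: eps_gt0 eps_le => e_gt0 e_le.
have [ez zge yge xge] := scales; have [y0 eyy eQ Q2 Qx] := scales_Q.
have x0 : 0 < x by rewrite -xy expR_gt0.
pose K := Num.truncn ((1 - eps) * Q).
have Qy : Q * y = x by rewrite divfK// gt_eqF.
have : 0 <= (1 - eps) * Q by nra.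
move=> /truncn_itv; rewrite -/K -natr1 => /andP[Kle Kgt].
(* This [L] makes 2^L exceed K^2 while staying logarithmic in [K]. *)
pose t := trunc_log 2 K; pose L := (2 * t.+1)%N.
have K0 : (0 < K)%N.
  by rewrite lt0n; apply/negP => /eqP K0; move: Kgt; rewrite K0; nra.
have Kt : (K < 2 ^ t.+1)%N by apply: trunc_log_ltn.
have L2 : (2 ^ L = 2 ^ t.+1 * 2 ^ t.+1)%N by rewrite /L mulnC expnM mulnn.
apply: (@le_trans _ _ ((K%:R - 1) / 2)); first by nra.
apply: (@RFF_forest_ge R n K L) => //.
- by rewrite L2; apply: leq_mul (ltnW Kt); rewrite expnS leq_pmulr// expn_gt0.
- by rewrite L2 -mulnn; apply: leq_mul; apply: ltnW.
have Kx : K%:R <= x by nra.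
have ty : t%:R <= 2 * y.
  have half2 : expR 2^-1 <= 2 :> R.
    have := expR_ge1Dx (- 2^-1 : R); rewrite expRN => h.
    have h' : 2^-1 <= (expR 2^-1)^-1 :> R by lra.
    by rewrite -lef_pV2 ?posrE ?expR_gt0.
  suff : t%:R * 2^-1 <= y by lra.
  rewrite -ler_expR xy; apply: le_trans Kx; rewrite expRM_natl.
  apply: (@le_trans _ _ (2 ^+ t)); first by rewrite lerXn2r ?nnegrE ?expR_ge0.
  by rewrite -natrX ler_nat trunc_logP.
(* The base is at most K(4t + 5) <= x(8y + 5), and the second factor is below e^(eps y). *)
have mle : (2 * K * L).+1%:R <= expR ((1 + eps) * y).
  have eey : 8 * y + 5 <= expR (eps * y).
    have h : 0 <= eps * y by rewrite mulr_ge0 ?ltW.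
    have := expR_ge1Dxn 1 h; rewrite (_ : 2`! = 2)%N// exprMn; nra.
  rewrite mulrDl mul1r expRD xy; apply: le_trans (ler_wpM2l (ltW x0) eey).
  apply: (@le_trans _ _ (K%:R * (4 * t%:R + 5))).
    have -> : K%:R * (4 * t%:R + 5) = (K * (4 * t + 5))%:R :> R.
      by rewrite natrM natrD natrM.
    by rewrite ler_nat /L; clear -K0; nia.
  by apply: ler_pM; rewrite ?addr_ge0 ?mulr_ge0//; lra.
rewrite -(ler_nat R) natrX -nx.
apply: (@le_trans _ _ (expR ((1 + eps) * y) ^+ K)).
  by rewrite lerXn2r ?nnegrE ?expR_ge0.
rewrite -expRM_natl ler_expR.
(* The exponent is at most (1 - eps)(1 + eps)Qy, which is below Qy = x. *)
have e0 : 0 <= (1 + eps) * y by nra.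
apply: le_trans (ler_wpM2r e0 Kle) _.
rewrite -[leRHS]Qy mulrACA [_ * (1 + eps)]mulrC mulrA.
have : 0 <= eps * eps * (Q * y) by rewrite Qy !mulr_ge0 ?ltW.
by nra.
Qed.

End Asymptotics.

Theorem theorem1 (R : realType) :
  exists d1 d2 : nat -> R,
    [/\ d1 n @[n --> \oo] --> (0 : R),
        d2 n @[n --> \oo] --> (0 : R) &
        \forall n \near \oo,
          (2^-1 - d1 n) * (ln (n%:R : R) / ln (ln (n%:R : R)))
            <= RFF R forest n
            <= (2^-1 + d2 n) * (ln (n%:R : R) / ln (ln (n%:R : R)))].
Proof.
pose x n : R := ln n%:R; pose y n : R := ln (x n); pose z n : R := ln (y n).
(* With this exact error, [- d] and [d] turn both inequalities into equalities; only the convergence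
   of [d] to 0 remains. *)
pose d n : R := RFF R forest n / (x n / y n) - 2^-1.
have scales_near C : \forall n \near \oo,
    [/\ expR (x n) = n%:R, expR (y n) = x n, expR (z n) = y n & C <= z n].
  near=> n.
  have nC : expR (expR (expR C)) <= n%:R by near: n; exact: nbhs_infty_ger.
  have n0 : 0 < n%:R :> R by apply: lt_le_trans nC; rewrite expR_gt0.
  have nx : expR (x n) = n%:R by rewrite lnK.
  have xC : expR (expR C) <= x n by rewrite -ler_expR nx.
  have xy : expR (y n) = x n by rewrite lnK// posrE (lt_le_trans _ xC) ?expR_gt0.
  have yC : expR C <= y n by rewrite -ler_expR xy.
  have yz : expR (z n) = y n by rewrite lnK// posrE (lt_le_trans _ yC) ?expR_gt0.
  by split=> //; rewrite -ler_expR yz.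
have d0 : d n @[n --> \oo] --> (0 : R).
  apply/cvgrPdist_le => eps eps0.
  (* The asymptotic bounds require [2 * e <= 1], hence the cap at 1/2. *)
  pose e := Num.min eps 2^-1.
  have e0 : 0 < e by rewrite lt_min eps0 invr_gt0/=.
  have ele : 2 * e <= 1.
    by rewrite mulrC -ler_pdivlMr// mul1r ge_min lexx orbT.
  have e_eps : e <= eps by rewrite ge_min lexx.
  near=> n.
  have [nx xy yz zC] : [/\ expR (x n) = n%:R, expR (y n) = x n,
      expR (z n) = y n & 100 / e ^+ 2 <= z n].
    by near: n; exact: scales_near.
  have zge : 100 <= e ^+ 2 * z n.
    by rewrite mulrC -ler_pdivrMr ?exprn_gt0.
  have Q0 : 0 < x n / y n by rewrite -[X in X / _]xy -yz divr_gt0 ?expR_gt0.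
  have lo := RFF_asymptotic_ge e0 ele nx xy yz zge.
  have hi := RFF_asymptotic_le e0 ele nx xy yz zge.
  rewrite -ler_pdivlMr// in lo; rewrite -ler_pdivrMr// in hi.
  by rewrite sub0r normrN ler_norml /d; apply/andP; split; lra.
exists (fun n => - d n), d; split=> //.
  by rewrite -oppr0; apply: cvgN.
near=> n.
have [nx xy yz z1] : [/\ expR (x n) = n%:R, expR (y n) = x n,
    expR (z n) = y n & 1 <= z n] by near: n; exact: scales_near.
have Q0 : 0 < x n / y n by rewrite -[X in X / _]xy -yz divr_gt0 ?expR_gt0.
have dQ : (2^-1 + d n) * (x n / y n) = RFF R forest n.
  by rewrite /d addrC subrK divfK ?gt_eqF.
by rewrite -/(x n) -/(y n) opprK dQ lexx.
Unshelve. all: by end_near.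
Qed.
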